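(* For all integers $n\ge1$ and $0\le m\le n^2-1$, $$\left\lceil \frac{n}{m+1}\right\rceil\ \ge\ \alpha(n,m)\ \ge\ \left\lceil \frac{n}{(m+1)^2}\right\rceil.$$
   Context: A quantum graph $G$ consists of a finite-dimensional complex inner product space $V(G)$ and a real vector space $E(G)$ of self-adjoint operators on $V(G)$ containing the identity $I$; write $|G|=\dim V(G)$ and $\|G\|=\dim E(G)-1$. A code of $G$ is a subspace $C\subseteq V(G)$ such that there is a function $\epsilon_C:E(G)\to\mathbb{R}$ with $P_CAP_C=\epsilon_C(A)P_C$ for all $A\in E(G)$, where $P_C$ is the orthogonal projection onto $C$. The independence number $\alpha(G)$ is the largest dimension of a code of $G$. $\alpha(n,m)$ is the minimum of $\alpha(G)$ over all quantum graphs $G$ with $|G|=n$ and $\|G\|=m$. *)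

(* Defs.v *)
From HB Require Import structures.
From mathcomp Require Import all_boot all_order all_algebra.
From Stdlib Require Import ClassicalEpsilon.
Set Implicit Arguments. Unset Strict Implicit. Unset Printing Implicit Defensive.
Import Order.TTheory GRing.Theory Num.Theory.
Local Open Scope ring_scope.
Local Open Scope sesquilinear_scope.

Section QuantumGraphs.
Variable C : numClosedFieldType.

(* V(G) = C^n (column vectors) with the standard inner product; operators are
   n x n matrices; M ^t* is the conjugate transpose (adjoint). *)
Definition selfadjoint n (A : 'M[C]_n) : Prop := A ^t* = A.

Definition in_real_span n k (B : 'I_k -> 'M[C]_n) (A : 'M[C]_n) : Prop :=
  exists c : 'I_k -> C, (forall i, c i \is Num.real) /\ A = \sum_(i < k) c i *: B i.

Definition real_lin_indep n k (B : 'I_k -> 'M[C]_n) : Prop :=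
  forall c : 'I_k -> C, (forall i, c i \is Num.real) ->
    \sum_(i < k) c i *: B i = 0 -> forall i, c i = 0.

(* A quantum graph G with |G| = n and ||G|| = m is given by a real basis
   B_0..B_m of E(G): self-adjoint, R-linearly independent, with I in E(G).
   E(G) is then the real span of B. *)
Definition qgraph n m (B : 'I_m.+1 -> 'M[C]_n) : Prop :=
  (forall i, selfadjoint (B i)) /\ real_lin_indep B /\ in_real_span B 1%:M.

(* Orthogonal projection P_C onto a subspace C of C^n; dim C = \rank P. *)
Definition orth_proj n (P : 'M[C]_n) : Prop := P *m P = P /\ P ^t* = P.

Definition has_code n m (B : 'I_m.+1 -> 'M[C]_n) (d : nat) : Prop :=
  exists P : 'M[C]_n, orth_proj P /\ \rank P = d /\
    exists eps : 'M[C]_n -> C,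
      forall A, in_real_span B A ->
        eps A \is Num.real /\ P *m A *m P = eps A *: P.

End QuantumGraphs.

Definition pb (P : Prop) : bool :=
  if excluded_middle_informative P then true else false.

(* alpha(G): largest dimension of a code (codes have dimension <= n). *)
Definition alphaG (C : numClosedFieldType) n m (B : 'I_m.+1 -> 'M[C]_n) : nat :=
  (\max_(d < n.+1 | pb (has_code B d)) d)%N.

(* alpha(n,m): minimum of alpha(G) over quantum graphs with |G| = n, ||G|| = m,
   computed as the greatest lower bound (in nat, bounded by n) of alpha(G). *)
Definition alpha_nm (C : numClosedFieldType) (n m : nat) : nat :=
  (\max_(a < n.+1 | pb (forall B : 'I_m.+1 -> 'M[C]_n, qgraph B -> (a <= alphaG B)%N)) a)%N.

Definition ceil_div (a b : nat) : nat := ((a + b.-1) %/ b)%N.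

(* Main.v *)
(* Lower bound: greedily choose nonzero vectors [v_i], each orthogonal to all
   [A v_j] with [A] in E(G) and [j < i]; about n/(m+1) of them exist, and every
   [A] compresses to a diagonal matrix on their span.  Tverberg's theorem for
   the points [(<v_i, B_l v_i>)_l] in dimension m+1 (not m: the coordinate of
   the identity makes the weights of all parts equal) splits them into
   ceil(n/(m+1)^2) groups with a common weighted sum; the vectors
   [\sum_(i in group) sqrt(la_i) v_i] span a code.  Tverberg's theorem is proved
   by Sarkaria's reduction to the colourful Caratheodory theorem.

   Upper bound: let E(G) contain the coordinate projections Q_0, Q_1, ... onto
   the classes of indices modulo m+1.  They sum to 1, so a nonzero code P has
   [P Q_l P = eps P] with [eps != 0] for some l, whence
   rank P <= rank Q_l <= ceil(n/(m+1)). *)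
Require Import Defs.
From HB Require Import structures.
From mathcomp Require Import all_boot all_order all_algebra.
From mathcomp Require Import ring lra zify.
From Stdlib Require Import ClassicalEpsilon.
Set Implicit Arguments. Unset Strict Implicit. Unset Printing Implicit Defensive.
Import Order.TTheory GRing.Theory Num.Theory.
Local Open Scope ring_scope.
Local Open Scope sesquilinear_scope.

Lemma pbP (P : Prop) : reflect P (pb P).
Proof. by rewrite /pb; case: excluded_middle_informative => H; constructor. Qed.

Lemma row_kernel_neq0 (F : fieldType) p q (A : 'M[F]_(p, q)) : (q < p)%N ->
  exists2 v : 'rV[F]_p, v != 0 & v *m A = 0.
Proof.
move=> qp; have /rowV0Pn[v /sub_kermxP vA v0] : kermx A != 0.
  by rewrite -mxrank_eq0 mxrank_ker subn_eq0 -ltnNge (leq_ltn_trans (rank_leq_col _)).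
by exists v.
Qed.

(** * Tverberg's theorem over an ordered field *)

Section Convex.
Variable R : realFieldType.

(** * Euclidean geometry of row vectors *)

Definition dotp D (u v : 'rV[R]_D) : R := (u *m v^T) 0 0.

Lemma dotpE D (u v : 'rV[R]_D) : dotp u v = \sum_i u 0 i * v 0 i.
Proof. by rewrite /dotp mxE; apply: eq_bigr => i _; rewrite mxE. Qed.

Lemma dotpC D (u v : 'rV[R]_D) : dotp u v = dotp v u.
Proof. by rewrite !dotpE; apply: eq_bigr => i _; rewrite mulrC. Qed.

Lemma dotpDl D (u v w : 'rV[R]_D) : dotp (u + v) w = dotp u w + dotp v w.
Proof. by rewrite /dotp mulmxDl mxE. Qed.

Lemma dotpZl D a (u w : 'rV[R]_D) : dotp (a *: u) w = a * dotp u w.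
Proof. by rewrite /dotp -scalemxAl mxE. Qed.

Lemma dotpDr D (u v w : 'rV[R]_D) : dotp w (u + v) = dotp w u + dotp w v.
Proof. by rewrite !(dotpC w) dotpDl. Qed.

Lemma dotpZr D a (u w : 'rV[R]_D) : dotp w (a *: u) = a * dotp w u.
Proof. by rewrite !(dotpC w) dotpZl. Qed.

Lemma dotp_ge0 D (u : 'rV[R]_D) : 0 <= dotp u u.
Proof. by rewrite dotpE sumr_ge0 // => i _; rewrite -expr2 sqr_ge0. Qed.

Lemma dotp_eq0 D (u : 'rV[R]_D) : (dotp u u == 0) = (u == 0).
Proof.
apply/eqP/eqP => [|->]; last by rewrite /dotp mul0mx mxE.
rewrite dotpE => /eqP; rewrite psumr_eq0 => [/allP u0|i _]; last first.
  by rewrite -expr2 sqr_ge0.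
apply/rowP => i; have := u0 i (mem_index_enum i).
by rewrite -expr2 sqrf_eq0 => /eqP->; rewrite mxE.
Qed.

Lemma dotp_sumr D (I : finType) (w : 'rV[R]_D) (u : I -> 'rV[R]_D) :
  dotp w (\sum_i u i) = \sum_i dotp w (u i).
Proof. by rewrite /dotp linear_sum mulmx_sumr summxE. Qed.

Lemma dotp_mulmxr k D (u : 'rV[R]_D) (nu : 'rV[R]_k) (X : 'M[R]_(k, D)) :
  dotp u (nu *m X) = dotp (u *m X^T) nu.
Proof. by rewrite /dotp trmx_mul mulmxA. Qed.

(** If [Z *m Z^T] kills a column [y], then [Z^T *m y] has norm zero. This makes the normal equations
    of least squares solvable. *)
Lemma trmx_sub_gram p q (Z : 'M[R]_(p, q)) : (Z^T <= Z *m Z^T)%MS.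
Proof.
rewrite submxE; set K := cokermx _.
have : Z *m Z^T *m K = 0 by exact: mulmx_coker.
move=> ZK; have : (Z^T *m K)^T *m (Z^T *m K) = 0.
  by rewrite trmx_mul trmxK -!mulmxA [X in _ *m X]mulmxA ZK mulmx0.
set M := Z^T *m K => MM; rewrite -(inj_eq trmx_inj) trmx0.
apply/eqP/row_matrixP => j.
rewrite row0; apply/eqP; rewrite -dotp_eq0; apply/eqP.
have := congr1 (fun A : 'M_p => A j j) MM; rewrite !mxE => <-.
by rewrite dotpE; apply: eq_bigr => i _; rewrite !mxE.
Qed.

(* The stationarity equations of the least-squares problem: minimise the norm
   of [mu *m Y] over the hyperplane [mu *m e^T = 1]. *)
Lemma affine_stationary k D (Y : 'M[R]_(k, D)) (e : 'rV[R]_k) : e != 0 ->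
  exists (mu : 'rV[R]_k) (c : R), dotp mu e = 1 /\ mu *m Y *m Y^T = c *: e.
Proof.
move=> e0; have ee : dotp e e != 0 by rewrite dotp_eq0.
pose K := kermx e^T; pose mu0 := (dotp e e)^-1 *: e; pose Z := K *m Y.
(* [mu0] lies on the hyperplane and the rows of [K] span its directions; [w] solves the normal
   equations in these coordinates. *)
have [w ZZ] : exists w, w *m (Z *m Z^T) = - (mu0 *m Y *m Z^T).
  have /submxP[w wE] := submx_trans (submxMl (- (mu0 *m Y)) _) (trmx_sub_gram Z).
  by exists w; rewrite -wE mulNmx.
pose mu := mu0 + w *m K; pose v := mu *m Y *m Y^T.
have Ke : K *m e^T = 0 by exact: mulmx_ker.
have vK : v *m K^T = 0.
  rewrite /v /mu -mulmxA -trmx_mul -/Z !mulmxDl -(mulmxA w) -/Z -(mulmxA w) ZZ.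
  by rewrite subrr.
(* The part [u] of [v] orthogonal to [e] lies in the row space of [K] and is also orthogonal to it,
   hence vanishes. *)
pose c := dotp v e / dotp e e; pose u := v - c *: e.
have uK : u *m K^T = 0.
  by rewrite mulmxBl vK -scalemxAl -[e]trmxK -trmx_mul Ke trmx0 scaler0 subrr.
have /sub_kermxP/submxP[w' uE] : u *m e^T = 0.
  apply/matrixP => i j; rewrite !ord1 -[LHS]/(dotp u e) mxE dotpDl -scaleNr dotpZl.
  by rewrite /c mulNr divfK // subrr.
have u0 : u = 0.
  apply/eqP; rewrite -dotp_eq0 /dotp {2}uE trmx_mul mulmxA uK mul0mx mxE.
  by [].
exists mu, c; split; last by apply/eqP; rewrite -subr_eq0 -/v -/u u0.
rewrite dotpDl dotpZl mulVf // /dotp -mulmxA Ke mulmx0 mxE addr0 //.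
Qed.

(** * Nearest points on faces of a convex hull *)

Definition simplex k (la : 'rV[R]_k) : Prop :=
  (forall i, 0 <= la 0 i) /\ \sum_i la 0 i = 1.

(* The point [la *m X] is the one nearest to 0 in the affine hull of the rows
   on which [la] is supported; in particular its norm depends only on the
   support.  This finiteness replaces compactness over an arbitrary field. *)
Definition critical k D (X : 'M[R]_(k, D)) (la : 'rV[R]_k) : Prop :=
  forall i, la 0 i != 0 ->
    (la *m X *m X^T) 0 i = dotp (la *m X) (la *m X).

(** The ratio test of the simplex method: a coordinate minimising [la 0 i / - de 0 i] among the
    decreasing ones is the first to reach zero. *)
Lemma exit_time k (la de : 'rV[R]_k) :
  (forall i, 0 <= la 0 i) -> (exists i, de 0 i < 0) ->
  exists2 t, 0 <= t & (forall i, 0 <= (la + t *: de) 0 i) /\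
    exists2 i, de 0 i < 0 & (la + t *: de) 0 i = 0.
Proof.
move=> la0 [i0 di0].
case: (arg_minP (P := fun i => de 0 i < 0) (fun i => la 0 i / - de 0 i) di0)
  => i di imin.
exists (la 0 i / - de 0 i); first by rewrite divr_ge0 // oppr_ge0 ltW.
split=> [j|]; last first.
  exists i => //; rewrite !mxE invrN mulrN mulNr divfK ?subrr //.
  by rewrite lt_eqF.
rewrite !mxE; have [dj|dj] := ltP (de 0 j) 0; last first.
  by rewrite addr_ge0 // mulr_ge0 // divr_ge0 // oppr_ge0 ltW.
have := imin j dj; rewrite ler_pdivlMr ?oppr_gt0 // mulrN => h.
by rewrite -lerBlDr sub0r.
Qed.

Lemma dotp_const k (u nu : 'rV[R]_k) c :
  (forall i, nu 0 i != 0 -> u 0 i = c) -> dotp u nu = c * \sum_i nu 0 i.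
Proof.
move=> uc; rewrite dotpE mulr_sumr; apply: eq_bigr => i _.
by have [->|/uc->//] := eqVneq (nu 0 i) 0; rewrite !mulr0.
Qed.

(** A 0/1 diagonal matrix erases the rows outside the support of [la], and [affine_stationary] is
    applied to what remains. *)
Lemma face_stationary k D (X : 'M[R]_(k, D)) (la : 'rV[R]_k) :
  \sum_i la 0 i = 1 ->
  exists (mu : 'rV[R]_k) (c : R),
    [/\ \sum_i mu 0 i = 1, forall i, la 0 i = 0 -> mu 0 i = 0 &
    forall i, la 0 i != 0 -> (mu *m X *m X^T) 0 i = c].
Proof.
move=> la1; pose e : 'rV[R]_k := \row_i (la 0 i != 0)%:R.
have e0 : e != 0.
  apply/eqP => /rowP e0; move/eqP: la1.
  rewrite big1 => [|i _]; first by rewrite eq_sym oner_eq0.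
  by have := e0 i; rewrite !mxE; case: eqP => //= _ /eqP; rewrite oner_eq0.
have [mu [c [mue st]]] := affine_stationary (diag_mx e *m X) e0.
exists (mu *m diag_mx e), c; split=> [|i li|i li].
- by rewrite -mue dotpE; apply: eq_bigr => i _; rewrite mul_mx_diag mxE.
- by rewrite mul_mx_diag !mxE li eqxx mulr0.
have eE : e 0 i = 1 by rewrite mxE li.
have := congr1 (fun A : 'rV_k => A 0 i) st; rewrite trmx_mul tr_diag_mx.
rewrite !mulmxA mul_mx_diag; set w := mu *m _ *m _ *m _.
by rewrite mxE [(c *: e) 0 i]mxE eE !mulr1.
Qed.

(** Induction on the size of the support. Let [mu] give the nearest point of the affine hull of the
    supporting rows. If [mu] is nonnegative, it is critical; otherwise the walk from [la] towards
    [mu] loses a coordinate by time 1, without increasing the norm. *)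
Lemma critical_below k D (X : 'M[R]_(k, D)) (la : 'rV[R]_k) : simplex la ->
  exists nu, [/\ simplex nu, critical X nu &
    dotp (nu *m X) (nu *m X) <= dotp (la *m X) (la *m X)].
Proof.
have [n] := ubnP #|[set i | la 0 i != 0]|; elim: n => // n IHn in la *.
rewrite ltnS => supn [la0 la1].
have [mu [c [mu1 mula muc]]] := face_stationary X la1.
have muS i : mu 0 i != 0 -> la 0 i != 0 by apply: contraNneq => /mula->.
set q := mu *m X; set p := la *m X.
have qq : dotp q q = c.
  by rewrite {2}/q dotp_mulmxr (dotp_const (c := c)) ?mu1 ?mulr1 // => i /muS /muc.
have qp : dotp q p = c.
  by rewrite {1}/p dotp_mulmxr (dotp_const (c := c)) ?la1 ?mulr1.
have pq : c <= dotp p p.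
  have := dotp_ge0 (p + -1 *: q); rewrite !(dotpDl, dotpDr, dotpZl, dotpZr).
  by rewrite qq (dotpC p q) qp; lra.
have [[i mui]|mu0] := excluded_middle_informative (exists i, mu 0 i < 0); last first.
  exists mu; split; rewrite -/q ?qq //; last by move=> i /muS /muc; rewrite -/q qq.
  by split=> // i; rewrite leNgt; apply/negP => ?; apply: mu0; exists i.
have [|t t0 [lt0 [j dj ltj]]] := exit_time (de := mu + -1 *: la) la0.
  by exists i; rewrite !mxE; have := la0 i; lra.
set la' := la + _ in lt0 ltj.
have t1 : t <= 1 by have := lt0 i; rewrite !mxE; have := la0 i; nra.
have la'1 : \sum_i la' 0 i = 1.
  rewrite (eq_bigr (fun i => la 0 i + t * (mu 0 i - la 0 i))).
    by rewrite big_split /= -mulr_sumr sumrB la1 mu1 subrr mulr0 addr0.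
  by move=> l _; rewrite !mxE mulN1r.
have sub : [set i | la' 0 i != 0] \proper [set i | la 0 i != 0].
  apply/properP; split.
    apply/subsetP => l; rewrite !inE; apply: contraNneq => l0.
    by rewrite !mxE l0 (mula _ l0) !(mulr0, addr0).
  exists j; rewrite inE ?ltj ?eqxx //; move: dj; rewrite !mxE => dj.
  by apply/eqP => l0; move: dj; rewrite l0 (mula _ l0) mulr0 addr0 ltxx.
have [||nu [snu cnu nule]] := IHn la'; first exact: leq_trans (proper_card sub) supn.
  by [].
exists nu; split=> //; apply: le_trans nule _; rewrite -/p.
(* Since [dotp q q] and [dotp q p] both equal [c], the squared norm at time [t] is
   [dotp p p - t * (2 - t) * (dotp p p - c)]. *)
have -> : la' *m X = p + t *: (q + -1 *: p).
  by rewrite /la' mulmxDl -scalemxAl mulmxDl -scalemxAl.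
rewrite !(dotpDl, dotpDr, dotpZl, dotpZr) qq (dotpC p q) qp.
have : 0 <= t * (2 - t) * (dotp p p - c).
  by apply: mulr_ge0; [apply: mulr_ge0 => //; lra | rewrite subr_ge0].
lra.
Qed.

(** * The colourful Caratheodory theorem *)

Section ColorfulCaratheodory.
Variables (D N r : nat) (x : 'I_N -> 'I_r -> 'rV[R]_D).
Hypotheses (DN : (D < N)%N) (r0 : (0 < r)%N).
Hypothesis x0 : forall i, \sum_j x i j = 0.

Definition selection (f : {ffun 'I_N -> 'I_r}) : 'M[R]_(N, D) := \matrix_i x i (f i).

(** On full support, take a linear dependency [v] of the rows. All rows have the same nonzero
    product with [la *m X], so the entries of [v] sum to zero; sliding along [v] keeps the point and
    the total weight until some weight vanishes. *)
Lemma drop_index (X : 'M[R]_(N, D)) la :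
  simplex la -> critical X la -> la *m X != 0 ->
  exists i nu, [/\ simplex nu, nu *m X = la *m X & nu 0 i = 0].
Proof.
move=> [la0 la1] cla p0.
have [[i li]|full] := excluded_middle_informative (exists i, la 0 i = 0).
  by exists i, la.
have cla' i : (la *m X *m X^T) 0 i = dotp (la *m X) (la *m X).
  by apply: cla; apply/eqP => li; apply: full; exists i.
have [v v0 vX] := row_kernel_neq0 X DN.
have v1 : \sum_i v 0 i = 0.
  have := dotp_const (nu := v) (fun i _ => cla' i).
  rewrite -dotp_mulmxr vX {1}/dotp trmx0 mulmx0 mxE => /esym/eqP.
  by rewrite mulf_eq0 dotp_eq0 (negPf p0) => /eqP.
have [|t _ [nu0 [i _ nui]]] := exit_time (de := v) la0.
  apply/existsP; rewrite -[X in is_true X]negbK negb_exists.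
  apply/negP => /forallP v_ge0.
  have {}v_ge0 i : 0 <= v 0 i by rewrite leNgt.
  move/eqP: v1; rewrite psumr_eq0 => [/allP v1|i _]; last exact: v_ge0.
  case/eqP: v0; apply/rowP => i; rewrite mxE; apply/eqP.
  exact: (v1 i (mem_index_enum i)).
exists i, (la + t *: v); split=> //; last first.
  by rewrite mulmxDl -scalemxAl vX scaler0 addr0.
split=> //; under eq_bigr do rewrite !mxE.
by rewrite big_split /= -mulr_sumr la1 v1 mulr0 addr0.
Qed.

(** A row of weight zero can be replaced without moving the point [p]. Its candidates [x i j] sum to
    zero, so one of them has a nonpositive product with [p], and a step towards it shortens [p]. *)
Lemma improve_selection f la :
  simplex la -> critical (selection f) la -> la *m selection f != 0 ->
  exists f' la', simplex la' /\
    dotp (la' *m selection f') (la' *m selection f') <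
    dotp (la *m selection f) (la *m selection f).
Proof.
move=> sla cla p0; have [i [nu [[nu0 nu1] nuE nui]]] := drop_index sla cla p0.
rewrite -!nuE in p0 *; set p := nu *m _ in p0 *.
have {}p0 : 0 < dotp p p by rewrite lt_def dotp_eq0 p0 dotp_ge0.
have [j dj] : exists j, dotp p (x i j) <= 0.
  apply/existsP; rewrite -[X in is_true X]negbK negb_exists.
  apply/negP => /forallP pos.
  have : \sum_j dotp p (x i j) = 0.
    by rewrite -dotp_sumr x0 /dotp trmx0 mulmx0 mxE.
  move/eqP; rewrite psumr_eq0 => [/allP z|j _]; last by rewrite ltW // ltNge.
  have := z (Ordinal r0) (mem_index_enum _); apply/negP.
  by rewrite gt_eqF // ltNge.
(* This [t] minimises [(1 - t)^2 P + t^2 Q], the squared norm in the orthogonal case; a negative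
   product only helps. *)
pose P := dotp p p; pose Q := dotp (x i j) (x i j); pose t := P / (P + Q).
have Q0 : 0 <= Q := dotp_ge0 _.
have PQ : 0 < P + Q by rewrite ltr_pwDl.
have tE : t * (P + Q) = P by rewrite divfK // gt_eqF.
have t0 : 0 < t by rewrite divr_gt0.
have t1 : t <= 1 by rewrite ler_pdivrMr // mul1r lerDl.
pose f' := [ffun l => if l == i then j else f l].
pose la' : 'rV[R]_N := (1 - t) *: nu + t *: delta_mx 0 i.
exists f', la'; split.
  split=> [l|].
    by rewrite !mxE addr_ge0 // mulr_ge0 ?subr_ge0 // ltW.
  under eq_bigr do rewrite !mxE eqxx.
  rewrite big_split /= -!mulr_sumr nu1 (bigD1 i) //= eqxx big1 => [|l /negPf->//].
  by rewrite addr0 !mulr1 subrK.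
have -> : la' *m selection f' = (1 - t) *: p + t *: x i j.
  rewrite mulmxDl -!scalemxAl -rowE rowK ffunE eqxx; congr (_ *: _ + _).
  apply/rowP => c; rewrite !mxE; apply: eq_bigr => l _; rewrite !mxE ffunE.
  by have [->|//] := eqVneq l i; rewrite nui !mul0r.
rewrite !(dotpDl, dotpDr, dotpZl, dotpZr) (dotpC (x i j) p) -/P -/Q.
set d := dotp p (x i j) in dj *.
have : t * (1 - t) * d <= 0 by rewrite mulr_ge0_le0 // mulr_ge0 ?subr_ge0 // ltW.
have : 0 < t * P by rewrite mulr_gt0.
have : t * t * (P + Q) = t * P by rewrite -mulrA tE.
nra.
Qed.

(* Barany's argument: minimise the norm over the finitely many pairs of a
   selection and a support that admit a critical point. *)
Lemma colorful_caratheodory : exists f la, simplex la /\ la *m selection f = 0.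
Proof.
pose T := ({ffun 'I_N -> 'I_r} * {set 'I_N})%type.
pose crit (s : T) la := [/\ simplex la, critical (selection s.1) la &
  [set i | la 0 i != 0] = s.2].
pose val (s : T) (la : 'rV[R]_N) := dotp (la *m selection s.1) (la *m selection s.1).
have val_uniq s la nu : crit s la -> crit s nu -> val s la = val s nu.
  move=> [[_ la1] cla sla] [[_ nu1] cnu snu].
  have lanu i : (la 0 i != 0) = (nu 0 i != 0).
    have := congr1 (fun A : {set 'I_N} => i \in A) (etrans sla (esym snu)).
    by rewrite !inE.
  have E1 : dotp (la *m selection s.1) (nu *m selection s.1) = val s la.
    rewrite dotp_mulmxr (dotp_const (c := val s la)) ?nu1 ?mulr1 // => i.
    by rewrite -lanu; apply: cla.
  have E2 : dotp (nu *m selection s.1) (la *m selection s.1) = val s nu.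
    rewrite dotp_mulmxr (dotp_const (c := val s nu)) ?la1 ?mulr1 // => i.
    by rewrite lanu; apply: cnu.
  by rewrite -E1 dotpC E2.
have [v vE] : exists v : T -> R, forall s la, crit s la -> val s la = v s.
  apply: (@fin_all_exists T (fun=> R)
    (fun s y => forall la, crit s la -> val s la = y)) => s.
  have [[la cla]|no] := excluded_middle_informative (exists la, crit s la).
    by exists (val s la) => nu cnu; apply: val_uniq.
  (* A default value: the minimum below is taken only over pairs that admit a critical point. *)
  by exists 0 => la cla; case: no; exists la.
have crit_exists f la : simplex la -> exists s nu, crit s nu /\
    v s <= dotp (la *m selection f) (la *m selection f).
  move=> sla; have [nu [snu cnu le]] := critical_below (selection f) sla.
  by exists (f, [set i | nu 0 i != 0]), nu; split=> //; rewrite -(vE _ nu).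
pose i0 : 'I_N := Ordinal (leq_ltn_trans (leq0n D) DN).
(* A vertex of the simplex shows that such pairs exist. *)
have [|s0 [la0 [c0 _]]] := crit_exists [ffun=> Ordinal r0] (delta_mx 0 i0).
  split=> [i|]; first by rewrite mxE ler0n.
  rewrite (bigD1 i0) //= !mxE eqxx big1 ?addr0 // => l /negPf h.
  by rewrite mxE h andbF.
have Ps0 : pb (exists la, crit s0 la) by apply/pbP; exists la0.
case: (arg_minP (P := fun s => pb (exists la, crit s la)) v Ps0)
  => s /pbP[la cla] smin.
exists s.1, la; have [sla crla _] := cla; split=> //.
apply/eqP; apply: contraT => p0.
have [f' [la' [sla' lt]]] := improve_selection sla crla p0.
have [s' [nu [cnu le]]] := crit_exists f' la' sla'.
have vs : v s <= v s' by apply: smin; apply/pbP; exists nu.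
by have := le_lt_trans (le_trans vs le) lt; rewrite -(vE _ _ cla) ltxx.
Qed.
End ColorfulCaratheodory.


(* Sarkaria's tensor trick: [u_0, ..., u_r] in dimension [r] sum to zero and
   satisfy no other linear relation, so a vanishing combination of the
   [u_(f i) (x) b_i] means that the [r+1] partial sums of the [b_i] agree. *)
Lemma tverberg d r N (b : 'I_N -> 'rV[R]_d) : (d * r < N)%N ->
  exists (f : 'I_N -> 'I_r.+1) (la : 'I_N -> R),
    [/\ forall i, 0 <= la i, exists i, 0 < la i &
     forall j, \sum_(i | f i == j) la i *: b i =
               \sum_(i | f i == ord_max) la i *: b i].
Proof.
rewrite mulnC => rdN.
(* The unit vectors for [j < r], and the vector with all entries -1 for [j = r]. *)
pose u (j : 'I_r.+1) : 'cV[R]_r :=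
  \col_k ((j == widen_ord (leqnSn r) k)%:R - (j == ord_max)%:R).
have u0 : \sum_j u j = 0.
  apply/colP => k; rewrite summxE mxE; under eq_bigr do rewrite mxE.
  rewrite sumrB (bigD1 (widen_ord (leqnSn r) k)) //= eqxx big1 => [|j /negPf->//].
  by rewrite (bigD1 ord_max) //= eqxx big1 ?subrr // => j /negPf->.
have [|f [la [[la0 la1] E]]] := @colorful_caratheodory (r * d) N r.+1
    (fun i j => mxvec (u j *m b i)) rdN (ltn0Sn r).
  by move=> i; rewrite -linear_sum -mulmx_suml u0 mul0mx linear0.
have {}E : \sum_i la 0 i *: (u (f i) *m b i) = 0.
  apply: (can_inj mxvecK); rewrite linear0 -E linear_sum mulmx_sum_row.
  by apply: eq_bigr => i _; rewrite linearZ rowK.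
exists f, (fun i => la 0 i); split=> // [|j].
  apply/existsP; apply: contraT; rewrite negb_exists => /forallP h.
  move/eqP: la1; rewrite big1 ?(eq_sym 0) ?oner_eq0 // => i _.
  by apply/eqP; rewrite eq_le la0 andbT leNgt.
have [jr|] := ltnP j r; last first.
  move=> rj; suff -> : j = ord_max by [].
  by apply/val_inj/eqP; rewrite /= eqn_leq rj -ltnS ltn_ord.
have -> : j = widen_ord (leqnSn r) (Ordinal jr) by apply: val_inj.
move: (Ordinal jr) => k; apply/eqP; rewrite -subr_eq0; apply/eqP/rowP => c.
have part j' : (\sum_(i | f i == j') la 0 i *: b i) 0 c =
    \sum_i (f i == j')%:R * (la 0 i * b i 0 c).
  rewrite summxE big_mkcond; apply: eq_bigr => i _; rewrite mxE.
  by case: eqP; rewrite (mul0r, mul1r).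
(* Row [k] of the tensor relation is part [k] minus the last part. *)
have Ekc := congr1 (fun A : 'M_(r, d) => A k c) E; rewrite summxE [RHS]mxE in Ekc.
rewrite !mxE !part -[RHS]Ekc -sumrB; apply: eq_bigr => i _; rewrite !mxE big_ord1 !mxE.
by rewrite -mulrBl mulrCA.
Qed.

End Convex.

(** * The ordered field of real elements *)

Section RealPart.
Variable C : numClosedFieldType.

(** [C] is only partially ordered; its real elements form the totally ordered field over which
    Tverberg's theorem is applied. *)
Record realpart := RealPart { rval :> C; rvalP : rval \is Num.real }.

HB.instance Definition _ := [isSub for rval].
HB.instance Definition _ := [Choice of realpart by <:].
HB.instance Definition _ := [SubChoice_isSubIntegralDomain of realpart by <:].
HB.instance Definition _ := [SubIntegralDomain_isSubField of realpart by <:].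

Let le (x y : realpart) := rval x <= rval y.
Let lt (x y : realpart) := rval x < rval y.
Let norm (x : realpart) := RealPart (normr_real (rval x)).

Fact le0_add x y : le 0 x -> le 0 y -> le 0 (x + y).
Proof. exact: addr_ge0. Qed.
Fact le0_mul x y : le 0 x -> le 0 y -> le 0 (x * y).
Proof. exact: mulr_ge0. Qed.
Fact le0_anti x : le 0 x -> le x 0 -> x = 0.
Proof. by move=> x0 x1; apply/val_inj/le_anti/andP. Qed.
Fact le_sub_ge0 x y : le 0 (y - x) = le x y.
Proof. exact: subr_ge0. Qed.
Fact le0_total x : le 0 x || le x 0.
Proof. exact: rvalP. Qed.
Fact normN x : norm (- x) = norm x.
Proof. exact/val_inj/normrN. Qed.
Fact le0_norm x : le 0 x -> norm x = x.
Proof. by move=> x0; apply/val_inj/ger0_norm. Qed.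
Fact lt_le_def x y : lt x y = (y != x) && le x y.
Proof. exact: lt_def. Qed.

HB.instance Definition _ := Num.IntegralDomain_isLeReal.Build realpart
  le0_add le0_mul le0_anti le_sub_ge0 le0_total normN le0_norm lt_le_def.

Lemma rval_zmod : zmod_morphism rval. Proof. by []. Qed.
Lemma rval_monoid : monoid_morphism rval. Proof. by []. Qed.
HB.instance Definition _ := GRing.isZmodMorphism.Build realpart C rval rval_zmod.
HB.instance Definition _ := GRing.isMonoidMorphism.Build realpart C rval rval_monoid.

End RealPart.

Lemma common_kernel_neq0 (F : fieldType) (J : finType) n (w : J -> 'rV[F]_n) :
  (#|J| < n)%N -> exists2 u : 'cV[F]_n, u != 0 & forall j, w j *m u = 0.
Proof.
move=> Jn; pose A := \matrix_(q < #|J|) w (enum_val q).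
have [x x0 xA] := row_kernel_neq0 A^T Jn.
exists x^T; first by rewrite trmx_eq0.
move=> j; have := congr1 (fun M : 'rV_#|J| => row (enum_rank j) M^T) xA.
by rewrite trmx_mul trmxK row_mul rowK enum_rankK trmx0 row0.
Qed.

(** * The lower bound *)

Section Codes.
Variable C : numClosedFieldType.

Lemma trmxC_mul p q r (A : 'M[C]_(p, q)) (B : 'M[C]_(q, r)) :
  (A *m B)^t* = B^t* *m A^t*.
Proof. by rewrite trmx_mul map_mxM. Qed.

Lemma trmxC_form n p (V : 'M[C]_(n, p)) (A : 'M[C]_n) : selfadjoint A ->
  (V^t* *m A *m V)^t* = V^t* *m A *m V.
Proof. by move=> sA; rewrite !trmxC_mul trmxCK sA mulmxA. Qed.

Lemma form_diag_real n p (V : 'M[C]_(n, p)) (A : 'M[C]_n) i : selfadjoint A ->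
  (V^t* *m A *m V) i i \is Num.real.
Proof.
move=> sA; apply/CrealP; have := congr1 (fun M : 'M_p => M i i) (trmxC_form V sA).
by rewrite mxE mxE.
Qed.

(** Each earlier vector imposes [m.+1] linear conditions on the next one, and the last of the [k]
    vectors has [k.-1] predecessors. *)
Lemma greedy_family n m (B : 'I_m.+1 -> 'M[C]_n) k :
  (forall l, selfadjoint (B l)) -> (m.+1 * k.-1 < n)%N ->
  exists v : nat -> 'cV[C]_n, forall i, (i < k)%N -> v i != 0 /\
    forall j, (j < k)%N -> i != j -> forall l, (v i)^t* *m B l *m v j = 0.
Proof.
move=> sB; elim: k => [|k IHk] kn; first by exists (fun=> 0).
have [v vP] := IHk (leq_ltn_trans (leq_mul (leqnn _) (leq_pred k)) kn).
have [|w w0 wP] := @common_kernel_neq0 C ('I_k * 'I_m.+1)%type n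
    (fun s => (v s.1)^t* *m B s.2).
  by rewrite card_prod !card_ord mulnC.
exists (fun i => if i == k then w else v i) => i; rewrite ltnS => ik.
have [->|ik'] := eqVneq i k; split=> //.
- move=> j; rewrite ltnS eq_sym => jk jk'; rewrite (negPf jk') => l.
  have {}jk : (j < k)%N by rewrite ltn_neqAle jk'.
  (* Self-adjointness of [B l] transfers the condition to the opposite order. *)
  have := congr1 (fun M => M^t*) (wP (Ordinal jk, l)).
  by rewrite !trmxC_mul trmxCK sB mulmxA trmx0 map_mx0.
- by have [] := vP i (_ : (i < k)%N); rewrite // ltn_neqAle ik' ik.
have {}ik : (i < k)%N by rewrite ltn_neqAle ik'.
move=> j; rewrite ltnS; have [->|jk'] := eqVneq j k => jk ij l.
  exact: (wP (Ordinal ik, l)).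
by have [_ ->] := vP i ik; rewrite // ltn_neqAle jk'.
Qed.

Lemma form_gt0 n (v : 'cV[C]_n) : v != 0 -> 0 < (v^t* *m v) 0 0.
Proof.
have E : (v^t* *m v) 0 0 = \sum_i `|v i 0| ^+ 2.
  by rewrite mxE; apply: eq_bigr => i _; rewrite !mxE normCKC.
move=> v0; rewrite E lt_def sumr_ge0 ?andbT => [|i _]; last exact: exprn_ge0.
apply: contraNneq v0 => /eqP; rewrite psumr_eq0 => [/allP h|i _]; last exact: exprn_ge0.
apply/eqP/colP => i; have := h i (mem_index_enum i).
by rewrite sqrf_eq0 normr_eq0 => /eqP->; rewrite mxE.
Qed.

Lemma greedy_frame n m (B : 'I_m.+1 -> 'M[C]_n) k :
  (forall l, selfadjoint (B l)) -> (m.+1 * k.-1 < n)%N ->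
  exists V : 'M[C]_(n, k), (forall i, 0 < (V^t* *m V) i i) /\
    forall l i j, i != j -> (V^t* *m B l *m V) i j = 0.
Proof.
move=> sB kn; have [v vP] := greedy_family sB kn.
pose V : 'M[C]_(n, k) := \matrix_(a, i) v i a 0.
have VE A (i j : 'I_k) : (V^t* *m A *m V) i j = ((v i)^t* *m A *m v j) 0 0.
  rewrite !mxE; apply: eq_bigr => a _; rewrite !mxE; congr (_ * _).
  by apply: eq_bigr => b _; rewrite !mxE.
exists V; split=> [i|l i j ij].
  by have := VE 1%:M i i; rewrite !mulmx1 => ->; apply: form_gt0; case: (vP i (ltn_ord i)).
by rewrite VE; have [_ ->] := vP i (ltn_ord i); rewrite ?mxE.
Qed.

Lemma has_code_frame n m (B : 'I_m.+1 -> 'M[C]_n) r (W : 'M[C]_(n, r.+1)) s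
    (y : 'I_m.+1 -> C) :
  (forall l, selfadjoint (B l)) -> 0 < s -> W^t* *m W = s%:M ->
  (forall l, W^t* *m B l *m W = (y l)%:M) -> has_code B r.+1.
Proof.
move=> sB s0 WW WBW; have sN0 : s != 0 by rewrite gt_eqF.
exists (s^-1 *: (W *m W^t*)); set P := _ *: _.
have PW : P *m W = W by rewrite -scalemxAl -mulmxA WW mul_mx_scalar scalerK.
split; [split|split].
- by rewrite {2}/P -scalemxAr mulmxA PW.
- rewrite /P linearZ /= map_mxZ trmxC_mul trmxCK.
  by congr (_ *: _); apply/CrealP; rewrite realV gtr0_real.
- apply/eqP; rewrite eqn_leq; apply/andP; split.
    rewrite (leq_trans (mxrankS (scalemx_sub _ (submx_refl _)))) //.
    by rewrite (leq_trans (mxrankM_maxl _ _)) ?rank_leq_col.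
  rewrite -[X in (X <= _)%N](_ : \rank (W^t* *m W) = r.+1).
    by rewrite -{2}PW (leq_trans (mxrankM_maxr _ _)) ?mxrankM_maxl.
  by rewrite WW -scalemx1 mxrank_scale_nz // mxrank1.
exists (fun A => (W^t* *m A *m W) 0 0 / s) => A [c [cR AE]].
have sA : selfadjoint A.
  rewrite /selfadjoint AE linear_sum raddf_sum; apply: eq_bigr => l _.
  by rewrite linearZ /= map_mxZ sB; congr (_ *: _); apply/CrealP.
split; first by rewrite realM ?form_diag_real // realV gtr0_real.
have {}AE : W^t* *m A *m W = (\sum_l c l * y l)%:M.
  rewrite AE mulmx_sumr mulmx_suml raddf_sum; apply: eq_bigr => l _.
  by rewrite -scalemxAr -scalemxAl WBW scale_scalar_mx.
set a := \sum_l _ in AE.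
have PAP : W *m W^t* *m A *m (W *m W^t*) = a *: (W *m W^t*).
  by rewrite -!mulmxA (mulmxA _ A) (mulmxA _ W) AE mul_scalar_mx -scalemxAr.
rewrite /P -!scalemxAl -scalemxAr PAP AE mxE mulr1n !scalerA.
by congr (_ *: _); rewrite mulrC mulrA.
Qed.

(** The columns of [S] have disjoint supports, and the square roots multiply back to the weights
    [la]. *)
Lemma compress_diag N r (D : 'M[C]_N) (f : 'I_N -> 'I_r) (la : 'I_N -> C) :
  (forall i, 0 <= la i) -> (forall i j, i != j -> D i j = 0) ->
  let S := \matrix_(i, j) ((f i == j)%:R * sqrtC (la i)) in
  S^t* *m D *m S = diag_mx (\row_j \sum_(i | f i == j) la i * D i i).
Proof.
move=> la0 Doff S; apply/matrixP => j j'; rewrite !mxE.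
have -> : \sum_i (S^t* *m D) j i * S i j' =
    \sum_i ((f i == j)%:R * (f i == j')%:R) * (la i * D i i).
  apply: eq_bigr => i _; rewrite mxE (bigD1 i) //= big1 => [|i' i'i]; last first.
    by rewrite Doff ?mulr0.
  rewrite addr0 !mxE rmorphM /= conjC_nat.
  have -> : (sqrtC (la i))^* = sqrtC (la i).
    by apply/CrealP/ger0_real; rewrite sqrtC_ge0.
  by rewrite -[in RHS](sqrtCK (la i)); ring.
have [<-|jj'] := eqVneq j j'.
  rewrite mulr1n [RHS]big_mkcond; apply: eq_bigr => i _.
  by case: eqP; rewrite ?mul1r ?mul0r.
rewrite big1 // => i _; have [fj|] := eqVneq (f i) j; last by rewrite !mul0r.
by rewrite fj (negPf jj') mulr0 mul0r.
Qed.

Lemma has_code_lower n m (B : 'I_m.+1 -> 'M[C]_n) r :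
  qgraph B -> (m.+1 ^ 2 * r < n)%N -> has_code B r.+1.
Proof.
(* [N] is the Tverberg number for [r.+1] parts in dimension [m.+1]; a frame of that size needs
   [m.+1 * (m.+1 * r) < n]. *)
move=> [sB [_ [c [cR IE]]]] rn; pose N := (m.+1 * r).+1.
have [|V [V0 Voff]] := @greedy_frame n m B N sB; first by rewrite /= mulnA.
pose q l i : realpart C := RealPart (form_diag_real V i (sB l)).
have [f [la [la0 [i0 lai0] E]]] :=
  tverberg (fun i : 'I_N => \row_l q l i) (ltnSn (m.+1 * r)).
pose la' i : C := rval (la i); have la'0 i : 0 <= la' i := la0 i.
pose S := \matrix_(i, j) ((f i == j)%:R * sqrtC (la' i)).
pose W := V *m S.
have WE A : W^t* *m A *m W = S^t* *m (V^t* *m A *m V) *m S.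
  by rewrite trmxC_mul !mulmxA.
pose y l := \sum_(i | f i == ord_max) la' i * (V^t* *m B l *m V) i i.
have WBW l : W^t* *m B l *m W = (y l)%:M.
  rewrite WE compress_diag //; last exact: Voff.
  rewrite -diag_const_mx; congr diag_mx; apply/rowP => j; rewrite !mxE.
  have part j' : \sum_(i | f i == j') la' i * (V^t* *m B l *m V) i i =
      rval ((\sum_(i | f i == j') la i *: \row_l q l i) 0 l).
    by rewrite summxE rmorph_sum; apply: eq_bigr => i _; rewrite 2![in RHS]mxE.
  by rewrite /y !part E.
have WA A : A = \sum_l c l *: B l -> W^t* *m A *m W = (\sum_l c l * y l)%:M.
  move=> ->; rewrite mulmx_sumr mulmx_suml raddf_sum; apply: eq_bigr => l _.
  by rewrite -scalemxAr -scalemxAl WBW scale_scalar_mx.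
have VVoff i j : i != j -> (V^t* *m 1%:M *m V) i j = 0.
  move=> ij; rewrite IE mulmx_sumr mulmx_suml summxE big1 // => l _.
  by rewrite -scalemxAr -scalemxAl mxE Voff ?mulr0.
have WW := WA _ IE.
apply: (has_code_frame (s := \sum_l c l * y l) sB _ _ WBW); last first.
  by rewrite -WW mulmx1.
(* All parts share one scale; on the part of [i0], which carries a positive weight, it is visibly
   positive. *)
have <- : \sum_(i | f i == f i0) la' i * (V^t* *m V) i i = \sum_l c l * y l.
  have := congr1 (fun M : 'M_r.+1 => M (f i0) (f i0)) WW; rewrite WE mulmx1.
  rewrite compress_diag // => [|i j ij]; last by rewrite -[V^t*]mulmx1 VVoff.
  by rewrite [LHS]mxE [RHS]mxE [(\row__ _) _ _]mxE eqxx !mulr1n.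
rewrite (bigD1 i0) //= ltr_wpDr // ?mulr_gt0 //.
by rewrite sumr_ge0 // => i _; rewrite mulr_ge0 // ltW.
Qed.

End Codes.

(** * The upper bound *)

Section SparseGraph.
Variables (C : numClosedFieldType) (n m : nat).

(* Numbers the off-diagonal positions of an [n x n] matrix by [n, ..., n ^ 2 - 1]. *)
Definition offdiag_code (a b : nat) : nat := (a + n * ((b + n - a) %% n))%N.

(** The factor of [n] in the code is the cyclic distance from [a] to [b], nonzero off the
    diagonal. *)
Lemma offdiag_code_ge (a b : 'I_n) : a != b -> (n <= offdiag_code a b)%N.
Proof.
rewrite -val_eqE /offdiag_code /= => ab; have := ltn_ord a; have := ltn_ord b.
move: (nat_of_ord a) (nat_of_ord b) ab => {}a {}b ab bn an.
suff : (0 < (b + n - a) %% n)%N by case: (_ %% n)%N => // t _; nia.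
have [lt_ab|le_ba] := ltnP a b.
  by rewrite addnC -addnBA ?(ltnW lt_ab) // modnDl modn_small; lia.
by rewrite modn_small; lia.
Qed.

(** The remainder of [l] modulo [n] is [a], and the quotient is the cyclic step from [a] to [b]. *)
Lemma offdiag_code_surj l : (n <= l)%N -> (l < n ^ 2)%N ->
  exists a b : 'I_n, a != b /\ offdiag_code a b = l.
Proof.
move=> nl ln; have n0 : (0 < n)%N by case: n ln => //; rewrite ltn0.
have t0 : (0 < l %/ n)%N by rewrite divn_gt0.
have tn : (l %/ n < n)%N by rewrite ltn_divLR // mulnn.
have an := ltn_pmod l n0; have lE := divn_eq l n.
pose b := ((l %% n + l %/ n) %% n)%N.
have bn : (b < n)%N by rewrite ltn_pmod.
suff [ab E] : (l %% n)%N != b /\ ((b + n - l %% n) %% n = l %/ n)%N.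
  exists (Ordinal an), (Ordinal bn); rewrite -val_eqE; split=> //.
  by rewrite /offdiag_code /= E [RHS]lE addnC mulnC.
rewrite /b; move: (l %% n)%N (l %/ n)%N an tn t0 => a t an tn t0.
have [lt|ge] := ltnP (a + t) n.
  rewrite (modn_small lt); split; first by lia.
  by rewrite -addnA addKn modnDr modn_small.
have -> : ((a + t) %% n = a + t - n)%N.
  by rewrite -[in LHS](subnK ge) modnDr modn_small; lia.
split; first by lia.
by rewrite subnK // addKn modn_small.
Qed.

(** The two codes of a symmetric pair of positions thus give a real symmetric and an imaginary
    antisymmetric matrix, as in the Pauli matrices. *)
Definition phase (a b : nat) : C := if (a < b)%N then 1 else 'i.

(* [sparse_basis l] is the projection onto the indices congruent to [l] when
   [l < n]; for [n <= l] it is a hermitian matrix supported on one symmetric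
   pair of off-diagonal positions, needed only when [n <= m]. *)
Definition sparse_basis (l : 'I_m.+1) : 'M[C]_n :=
  \matrix_(a, b) if a == b then (a %% m.+1 == l)%N%:R else
    (offdiag_code a b == l)%:R * phase a b + (offdiag_code b a == l)%:R * (phase b a)^*.

Lemma sparse_basis_selfadjoint l : selfadjoint (sparse_basis l).
Proof.
apply/matrixP => a b; rewrite !mxE (eq_sym b a); have [<-|_] := eqVneq a b.
  by rewrite conjC_nat.
by rewrite rmorphD !rmorphM /= !conjC_nat conjCK addrC.
Qed.

Lemma sum_indicator (c : 'I_m.+1 -> C) (l : 'I_m.+1) :
  \sum_i c i * (nat_of_ord l == i)%:R = c l.
Proof.
rewrite (bigD1 l) //= eqxx mulr1 big1 ?addr0 // => i; rewrite -val_eqE /= eq_sym.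
by move=> /negPf->; rewrite mulr0.
Qed.

Lemma real_imag_eq0 (x y : C) : x \is Num.real -> y \is Num.real ->
  x + 'i * y = 0 -> x = 0 /\ y = 0.
Proof.
move=> xR yR E; have := congr1 (fun z => 'Re z) E; have := congr1 (fun z => 'Im z) E.
by rewrite Re_rect // Im_rect // !raddf0.
Qed.

Lemma sparse_basis_indep : (m < n ^ 2)%N -> real_lin_indep sparse_basis.
Proof.
move=> mn c cR E l; have ln : (l < n ^ 2)%N by apply: leq_trans mn; apply: ltn_ord.
have entry a b : \sum_i c i * sparse_basis i a b = 0.
  have := congr1 (fun M : 'M_n => M a b) E; rewrite summxE [RHS]mxE => Eab.
  by rewrite -[RHS]Eab; apply: eq_bigr => i _; rewrite [RHS]mxE.
have [nl|nl] := ltnP l n.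
  rewrite -[RHS](entry (Ordinal nl) (Ordinal nl)) -[LHS]sum_indicator.
  apply: eq_bigr => i _; rewrite mxE eqxx /= modn_small //.
have [a [b [ab El]]] := offdiag_code_surj nl ln.
(* The coefficient belonging to the mirror position, or 0 when its code exceeds [m]. *)
pose d := \sum_i c i * (offdiag_code b a == i)%:R.
have dR : d \is Num.real.
  by apply: rpred_sum => i _; rewrite realM ?cR // realn.
have {entry} : c l * phase a b + d * (phase b a)^* = 0.
  rewrite -[RHS](entry a b) -[c l]sum_indicator !mulr_suml -big_split /=.
  by apply: eq_bigr => i _; rewrite mxE (negPf ab) El mulrDr !mulrA.
rewrite /phase; case: ltngtP => [_|_|/val_inj]; last by move/eqP; rewrite (negPf ab).
  rewrite conjCi mulr1 mulrN -mulNr (mulrC (- d)).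
  by move/real_imag_eq0 => []; rewrite ?rpredN.
by rewrite conjC1 mulr1 addrC mulrC => /real_imag_eq0 [].
Qed.

(** Residues modulo [m.+1] of indices below [n] are themselves below [n], so the projections with
    [l < n] cover the whole diagonal. *)
Lemma sparse_basis_sum1 :
  \sum_(l < m.+1) ((l < n)%N%:R : C) *: sparse_basis l = 1%:M.
Proof.
apply/matrixP => a b; rewrite summxE !mxE.
have [<-|ab] := eqVneq a b.
  have an : (a %% m.+1 < n)%N by rewrite (leq_ltn_trans (leq_mod _ _)).
  have := sum_indicator (fun i => (i < n)%N%:R) (Ordinal (ltn_pmod a (ltn0Sn m))).
  by rewrite an => E; apply: etrans E; apply: eq_bigr => i _; rewrite !mxE eqxx.
rewrite big1 // => i _; rewrite !mxE (negPf ab).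
have [lt|_] := ltnP i n; last by rewrite mul0r.
have neq (a' b' : 'I_n) : a' != b' -> (offdiag_code a' b' == i) = false.
  by move/offdiag_code_ge => h; rewrite gtn_eqF // (leq_trans lt h).
by rewrite (neq _ _ ab) (neq b a) ?(eq_sym b) // !mul0r addr0 mulr0.
Qed.

Lemma sparse_basis_qgraph : (m < n ^ 2)%N -> qgraph sparse_basis.
Proof.
move=> mn; split; first exact: sparse_basis_selfadjoint.
split; first exact: sparse_basis_indep.
by exists (fun l => (l < n)%N%:R); split=> [i|]; rewrite ?realn ?sparse_basis_sum1.
Qed.

Lemma sparse_basis_rank (l : 'I_m.+1) : (l < n)%N ->
  (\rank (sparse_basis l) <= ceil_div n m.+1)%N.
Proof.
move=> ln; set k := ceil_div _ _.
(* Column [t] is the unit vector at [t * m.+1 + l], or zero if that index is not below [n]. *)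
pose U : 'M[C]_(n, k) := \matrix_(a, t) (nat_of_ord a == t * m.+1 + l)%N%:R.
suff -> : sparse_basis l = U *m U^T.
  by rewrite (leq_trans (mxrankM_maxl _ _)) ?rank_leq_col.
have UE a t : U a t = (a %/ m.+1 == t)%N%:R * (a %% m.+1 == l)%N%:R.
  rewrite mxE -natrM mulnb; congr (nat_of_bool _)%:R.
  apply/eqP/andP => [->|[/eqP<- /eqP<-]]; last exact: divn_eq.
  by rewrite divnMDl // modnMDl divn_small ?modn_small ?addn0.
apply/matrixP => a b; rewrite [RHS]mxE.
have ak : (a %/ m.+1 < k)%N.
  rewrite /k /ceil_div ltn_divLR //=; have := ltn_ord a; have := divn_eq (n + m) m.+1.
  have := ltn_pmod (n + m) (ltn0Sn m); lia.
under eq_bigr do rewrite [U^T _ _]mxE.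
rewrite (bigD1 (Ordinal ak)) //= big1 ?addr0 => [|t]; last first.
  by rewrite -val_eqE UE /= eq_sym => /negPf->; rewrite !mul0r.
rewrite !UE /= eqxx mul1r mxE; have [<-|ab] := eqVneq a b.
  by rewrite eqxx mul1r; case: eqP => _; rewrite ?mulr1 ?mulr0.
have neq (a' b' : 'I_n) : a' != b' -> (offdiag_code a' b' == l) = false.
  by move/offdiag_code_ge => h; rewrite gtn_eqF // (leq_trans ln h).
rewrite (neq _ _ ab) (neq b a) ?(eq_sym b) // !mul0r addr0.
case: eqP => [al|]; rewrite ?mul0r //.
case: eqP => [t|]; rewrite ?mul0r ?mulr0 //; case: eqP => [bl|]; rewrite ?mulr0 //.
case/eqP: ab; apply: val_inj => /=.
by rewrite [LHS](divn_eq _ m.+1) [RHS](divn_eq _ m.+1) al bl t.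
Qed.

Lemma sparse_basis_code_le d : has_code sparse_basis d -> (d <= ceil_div n m.+1)%N.
Proof.
move=> [P [[PP _] [<- [eps epsP]]]].
have [->|P0] := eqVneq P 0; first by rewrite mxrank0.
have inB l : in_real_span sparse_basis (sparse_basis l).
  exists (fun i => (i == l)%:R); split=> [i|]; first exact: realn.
  rewrite (bigD1 l) //= eqxx scale1r big1 ?addr0 // => i /negPf->.
  by rewrite scale0r.
have [l /andP[ln el]] : exists l : 'I_m.+1, (l < n)%N && (eps (sparse_basis l) != 0).
  apply/existsP; apply: contraT; rewrite negb_exists => /forallP h.
  case/eqP: P0; rewrite -PP -{2}[P]mul1mx -sparse_basis_sum1 mulmxA.
  rewrite mulmx_sumr mulmx_suml big1 // => l _.
  rewrite -scalemxAr -scalemxAl; have [_ ->] := epsP _ (inB l).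
  have := h l; case: ltnP => _ /=; rewrite ?scale0r // negbK => /eqP->.
  by rewrite scale0r scaler0.
have [_ E] := epsP _ (inB l); apply: leq_trans (sparse_basis_rank ln).
rewrite -(mxrank_scale_nz P el) -E.
by rewrite (leq_trans (mxrankM_maxl _ _)) ?mxrankM_maxr.
Qed.

End SparseGraph.

Theorem theorem1 (C : numClosedFieldType) (n m : nat) :
  (1 <= n)%N -> (m <= n ^ 2 - 1)%N ->
  (ceil_div n (m + 1) >= alpha_nm C n m)%N /\
  (alpha_nm C n m >= ceil_div n ((m + 1) ^ 2))%N.
Proof.
move=> n1 mn; rewrite addn1.
have {}mn : (m < n ^ 2)%N.
  by rewrite -[X in (_ < X)%N]prednK ?expn_gt0 ?n1 // ltnS -subn1.
split.
  apply/bigmax_leqP => a /pbP/(_ _ (sparse_basis_qgraph C mn))/leq_trans; apply.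
  by apply/bigmax_leqP => d /pbP; apply: sparse_basis_code_le.
set q := (m.+1 ^ 2)%N; have q0 : (0 < q)%N by rewrite expn_gt0.
(* For [n >= 1] the ceiling of [n / q] is [r.+1], and [q * r < n] is the bound needed for a code of
   that dimension. *)
pose r := ((n - 1) %/ q)%N.
have -> : ceil_div n q = r.+1.
  by rewrite /ceil_div (_ : (n + q.-1 = n - 1 + 1 * q)%N) ?divnMDl ?divnDMl ?addn1 //; lia.
have rn : (q * r < n)%N by rewrite mulnC; have := leq_trunc_div (n - 1) q; lia.
(* Both maxima, in [alpha_nm] and in [alphaG], range over numbers up to [n], so [r.+1] must be an
   admissible index. *)
have code_n : (r.+1 < n.+1)%N by rewrite ltnS (leq_trans _ rn) // ltnS leq_pmull.
apply: (leq_bigmax_cond (Ordinal code_n)).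
apply/pbP => B qB; apply: (leq_bigmax_cond (Ordinal code_n)).
by apply/pbP; apply: has_code_lower.
Qed.
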